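(* Let $n\ge1$. The class of $(\langle\ \rangle;,\mathsf A_1,\dots,\mathsf A_n,\cdot,\sqcup)$-algebras that are representable by injective $n$-ary partial functions is a variety, finitely axiomatised by the following equations (each universally quantified over all element variables occurring in it): (1) $\langle \boldsymbol a; b_1,\dots,\boldsymbol a; b_n\rangle ; c = \boldsymbol a;(\boldsymbol b; c)$; (2) $\boldsymbol\pi; a = a$; (3) $\langle \mathsf A_1^n a\rangle; a = 0$ (i.e. $\langle \mathsf A_1^n a\rangle; a=\langle \mathsf A_1^n b\rangle; b$ for all $a,b$, so that $0$ is a well-defined constant); (4) $\langle a_1,\dots,a_{i-1},0,a_{i+1},\dots,a_n\rangle; b = 0$ for every $i$; (5) $\boldsymbol a; 0 = 0$; (6) $\boldsymbol a;\mathsf A_i b = \langle \mathsf A_1^n(\boldsymbol a; b)\rangle;\langle \mathsf D_1^n a_1\rangle;\cdots;\langle \mathsf D_1^n a_n\rangle; a_i$ for every $i$; (7) $\langle \mathsf D_1^n a\rangle; a = a$; (8) $\mathsf A_i\mathsf A_j a=\mathsf A_i\mathsf A_k a$ for every $i,j,k$; (9) $a\cdot a=a$; (10) $a\cdot b=b\cdot a$; (11) $\boldsymbol a;(b\cdot c)=(\boldsymbol a; b)\cdot(\boldsymbol a; c)$; (12) $\langle \mathsf D_1^n(a\cdot b)\rangle; a=a\cdot b$; (13) $\langle a\bowtie_1 b,\dots,a\bowtie_n b\rangle; a=\langle a\bowtie_1 b,\dots,a\bowtie_n b\rangle; b$; (14) $\big(\boldsymbol\alpha;\mathsf D_i(\boldsymbol\alpha;(a\cdot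 b))\big) +_i \big(\boldsymbol\alpha;\langle \mathsf A_1^n(\boldsymbol\alpha; a)\rangle;\mathsf A_i(\boldsymbol\alpha; b)\big)=\boldsymbol\alpha;(a\bowtie_i b)$ for every $i$, where $\boldsymbol\alpha=\langle \mathsf A_1 d,\dots,\mathsf A_n d\rangle$ with $d$ an arbitrary element; (15) $\big(\langle \mathsf D_1^n a\rangle;(b\bowtie_i c)\big)+_i\big(\langle \mathsf A_1^n a\rangle;(b\bowtie_i c)\big)=b\bowtie_i c$ for every $i$; (16) $\langle \mathsf D_1^n((\boldsymbol b; a)\cdot(\boldsymbol c; a))\rangle;\mathsf A_i(b_i\bowtie_i c_i)=0$ for every $i$; (17) $\langle \mathsf D_1^n a\rangle;(a\sqcup b)=a$; (18) $\langle \mathsf A_1^n a\rangle;(a\sqcup b)=\langle \mathsf A_1^n a\rangle; b$.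
   Context: Fix $n\ge 1$; indices $i,j,k$ range over $\{1,\dots,n\}$. The signature has an $(n+1)$-ary operation (composition), written $\langle a_1,\dots,a_n\rangle ; b$, unary operations $\mathsf A_1,\dots,\mathsf A_n$, and binary operations $\cdot$ and $\sqcup$. Algebras are nonempty. An $n$-ary partial function on a set $X$ is a set $f\subseteq X^{n+1}$ such that $(\boldsymbol x,y),(\boldsymbol x,z)\in f$ implies $y=z$ (where $\boldsymbol x\in X^n$); it is injective if $(\boldsymbol x,z),(\boldsymbol y,z)\in f$ implies $\boldsymbol x=\boldsymbol y$. An algebra of $n$-ary partial functions of this signature is an algebra whose elements are $n$-ary partial functions, for which there are a set $X$ (the base) and an equivalence relation $E$ on $X$ such that every tuple $(x_1,\dots,x_{n+1})$ in every element lies in $X^{n+1}$ and has pairwise $E$-equivalent entries, and whose operations are $\boldsymbol f; g=\{(\boldsymbol x,z)\in X^{n+1} : \exists \boldsymbol y\in X^n,\ (\boldsymbol x,y_i)\in f_i \text{ for each } i \text{ and } (\boldsymbol y,z)\in g\}$, $\mathsf A_i(f)=\{(\boldsymbol x,x_i)\in X^{n+1} : x_1,\dots,x_n \text{ all } E\text{-equivalent and there is no } y\in X \text{ with } (\boldsymbol x,y)\in f\}$, $f\cdot g=f\cap g$, and preferential union: $(f\sqcup g)(\boldsymbol x)$ is $f(\boldsymbol x)$ if $f(\boldsymbol x)$ is defined, $g(\boldsymbol x)$ if $f(\boldsymbol x)$ is undefined but $g(\boldsymbol x)$ is defined, and undefined otherwise. An algebra is representable by injective $n$-ary partial functions if it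 is isomorphic to an algebra of $n$-ary partial functions of the same signature all of whose elements are injective. Notation: a bold symbol $\boldsymbol a$ in a term $\boldsymbol a; b$ stands for $\langle a_1,\dots,a_n\rangle$; unbracketed compositions associate to the right ($\boldsymbol a;\boldsymbol b; c=\boldsymbol a;(\boldsymbol b; c)$); for unary operations $\mathsf B_1,\dots,\mathsf B_n$, $\langle \mathsf B_1^n a\rangle$ means $\langle \mathsf B_1 a,\dots,\mathsf B_n a\rangle$. Abbreviations: $0:=\langle \mathsf A_1^n b\rangle; b$ for any $b$; $\pi_i:=\mathsf A_i 0$; $\boldsymbol\pi:=\langle\pi_1,\dots,\pi_n\rangle$; $\mathsf D_i a:=\mathsf A_i\mathsf A_i a$; $\alpha+_i\beta:=\mathsf A_i(\langle \mathsf A_1^n\alpha\rangle;\mathsf A_i\beta)$; $a\bowtie_i b:=\mathsf D_i(a\cdot b)+_i(\langle \mathsf A_1^n a\rangle;\mathsf A_i b)$. *)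

(* Defs.v *)
From mathcomp Require Import all_boot.
From mathcomp Require Import boolp classical_sets.
From Stdlib Require List.
From Stdlib Require Import RelationClasses.

Set Implicit Arguments.
Unset Strict Implicit.
Unset Printing Implicit Defensive.

Declare Scope alg_scope.
Delimit Scope alg_scope with alg.
Local Open Scope classical_set_scope.
Local Open Scope alg_scope.

(* The indices 1, ..., n are represented by the elements of 'I_n, and n-tuples
   of elements of T by functions 'I_n -> T. *)

Record alg (n : nat) := Alg {
  carrier :> Type;
  comp : ('I_n -> carrier) -> carrier -> carrier;
  anti : 'I_n -> carrier -> carrier;
  meet : carrier -> carrier -> carrier;
  pref : carrier -> carrier -> carrier;
  alg_nonempty : inhabited carrier }.

Arguments comp {n a} _ _.
Arguments anti {n a} _ _.
Arguments meet {n a} _ _.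
Arguments pref {n a} _ _.

Notation "a ;; b" := (comp a b) (at level 45, right associativity) : alg_scope.
Notation "a ** b" := (meet a b) (at level 40, left associativity) : alg_scope.
Notation "a |_| b" := (pref a b) (at level 40, left associativity) : alg_scope.

Record is_hom (n : nat) (A B : alg n) (h : A -> B) : Prop := IsHom {
  hom_comp : forall a b, h (a ;; b) = (fun i => h (a i)) ;; h b;
  hom_anti : forall i a, h (anti i a) = anti i (h a);
  hom_meet : forall a b, h (a ** b) = h a ** h b;
  hom_pref : forall a b, h (a |_| b) = h a |_| h b }.

Definition isomorphic (n : nat) (A B : alg n) : Prop :=
  exists h : A -> B, is_hom h /\ bijective h.

Record subuniverse (n : nat) (A : alg n) := Subuniverse {
  sub_set :> A -> Prop;
  sub_nonempty : exists a, sub_set a;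
  sub_comp : forall a b, (forall i, sub_set (a i)) -> sub_set b ->
    sub_set (a ;; b);
  sub_anti : forall i a, sub_set a -> sub_set (anti i a);
  sub_meet : forall a b, sub_set a -> sub_set b -> sub_set (a ** b);
  sub_pref : forall a b, sub_set a -> sub_set b -> sub_set (a |_| b) }.

Definition sub_alg (n : nat) (A : alg n) (S : subuniverse A) : alg n :=
  @Alg n {a : A | S a}
    (fun a b => exist _ (comp (fun i => sval (a i)) (sval b))
                  (sub_comp (fun i => svalP (a i)) (svalP b)))
    (fun i a => exist _ (anti i (sval a)) (sub_anti i (svalP a)))
    (fun a b => exist _ (sval a ** sval b) (sub_meet (svalP a) (svalP b)))
    (fun a b => exist _ (sval a |_| sval b) (sub_pref (svalP a) (svalP b)))
    (let: ex_intro a Sa := sub_nonempty S in inhabits (exist _ a Sa)).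

Lemma prod_nonempty (n : nat) (I : Type) (A : I -> alg n) :
  inhabited (forall k, A k).
Proof.
by constructor=> k; apply: inhabited_witness; apply: alg_nonempty.
Qed.

Definition prod_alg (n : nat) (I : Type) (A : I -> alg n) : alg n :=
  @Alg n (forall k, A k)
    (fun a b k => (fun i => a i k) ;; b k)
    (fun i a k => anti i (a k))
    (fun a b k => a k ** b k)
    (fun a b k => a k |_| b k)
    (prod_nonempty A).

Record is_variety (n : nat) (K : alg n -> Prop) : Prop := IsVariety {
  variety_H : forall (A B : alg n) (h : A -> B),
    is_hom h -> (forall b, exists a, h a = b) -> K A -> K B;
  variety_S : forall (A : alg n) (S : subuniverse A), K A -> K (sub_alg S);
  variety_P : forall (I : Type) (A : I -> alg n),
    (forall k, K (A k)) -> K (prod_alg A) }.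

Inductive term (n : nat) : Type :=
| Var of nat
| Comp of ('I_n -> term n) & term n
| Anti of 'I_n & term n
| Meet of term n & term n
| Pref of term n & term n.

(* Terms form an algebra, so that the derived operations below, which make
   sense in any algebra, can be used to write equations. *)
Definition term_alg (n : nat) : alg n :=
  @Alg n (term n) (@Comp n) (@Anti n) (@Meet n) (@Pref n) (inhabits (Var n 0)).

Fixpoint eval (n : nat) (A : alg n) (v : nat -> A) (t : term n) : A :=
  match t with
  | Var k => v k
  | Comp s u => (fun i => eval v (s i)) ;; eval v u
  | Anti i s => anti i (eval v s)
  | Meet s u => eval v s ** eval v u
  | Pref s u => eval v s |_| eval v u
  end.

Record equation (n : nat) := Equation { lhs : term_alg n; rhs : term_alg n }.

Notation "s =~ t" := (Equation s t) (at level 70, no associativity) : alg_scope.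

Definition satisfies (n : nat) (A : alg n) (e : equation n) : Prop :=
  forall v : nat -> A, eval v (lhs e) = eval v (rhs e).

Definition models (n : nat) (A : alg n) (es : seq (equation n)) : Prop :=
  List.Forall (satisfies A) es.

Section Derived.
Variables (n : nat) (A : alg n).
Implicit Types (a b : A) (i : 'I_n).

Definition antis a : 'I_n -> A := fun i => anti i a.
Definition dom i a : A := anti i (anti i a).
Definition doms a : 'I_n -> A := fun i => dom i a.

(* The constant 0 is [zero z] for an arbitrary z. *)
Definition zero z : A := antis z ;; z.
Definition proj z : 'I_n -> A := fun i => anti i (zero z).

Definition plus i a b : A := anti i (antis a ;; anti i b).
Definition tie i a b : A := plus i (dom i (a ** b)) (antis a ;; anti i b).
Definition ties a b : 'I_n -> A := fun i => tie i a b.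

(* <D_1^n a_1> ; ... ; <D_1^n a_n> ; b, associated to the right *)
Definition restr (a : 'I_n -> A) b : A :=
  foldr (fun j t => doms (a j) ;; t) b (enum 'I_n).

End Derived.

Section Equations.
Variable n : nat.
Implicit Types i j k : 'I_n.

(* Pairwise distinct variables: five single ones, and three n-tuples.
   The variable z is only used as the argument of [zero] and [proj]. *)
Let a : term_alg n := Var n 0.
Let b : term_alg n := Var n 1.
Let c : term_alg n := Var n 2.
Let d : term_alg n := Var n 3.
Let z : term_alg n := Var n 4.
Let aa : 'I_n -> term_alg n := fun i => Var n (5 + 3 * i).
Let bb : 'I_n -> term_alg n := fun i => Var n (6 + 3 * i).
Let cc : 'I_n -> term_alg n := fun i => Var n (7 + 3 * i).

Definition ax1 := (fun i => aa ;; bb i) ;; c =~ aa ;; bb ;; c.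
Definition ax2 := proj z ;; a =~ a.
Definition ax3 := antis a ;; a =~ antis b ;; b.
Definition ax4 i := (fun j => if j == i then zero z else aa j) ;; b =~ zero z.
Definition ax5 := aa ;; zero z =~ zero z.
Definition ax6 i := aa ;; anti i b =~ antis (aa ;; b) ;; restr aa (aa i).
Definition ax7 := doms a ;; a =~ a.
Definition ax8 i j k := anti i (anti j a) =~ anti i (anti k a).
Definition ax9 := a ** a =~ a.
Definition ax10 := a ** b =~ b ** a.
Definition ax11 := aa ;; (b ** c) =~ (aa ;; b) ** (aa ;; c).
Definition ax12 := doms (a ** b) ;; a =~ a ** b.
Definition ax13 := ties a b ;; a =~ ties a b ;; b.
Definition ax14 i :=
  let al := antis d in
  plus i (al ;; dom i (al ;; (a ** b)))
         (al ;; antis (al ;; a) ;; anti i (al ;; b))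
  =~ al ;; tie i a b.
Definition ax15 i :=
  plus i (doms a ;; tie i b c) (antis a ;; tie i b c) =~ tie i b c.
Definition ax16 i :=
  doms ((bb ;; a) ** (cc ;; a)) ;; anti i (tie i (bb i) (cc i)) =~ zero z.
Definition ax17 := doms a ;; (a |_| b) =~ a.
Definition ax18 := antis a ;; (a |_| b) =~ antis a ;; b.

Definition axioms : seq (equation n) :=
  [:: ax1; ax2; ax3]
  ++ [seq ax4 i | i : 'I_n]
  ++ [:: ax5]
  ++ [seq ax6 i | i : 'I_n]
  ++ [:: ax7]
  ++ [seq ax8 p.1.1 p.1.2 p.2 | p : 'I_n * 'I_n * 'I_n]
  ++ [:: ax9; ax10; ax11; ax12; ax13]
  ++ [seq ax14 i | i : 'I_n]
  ++ [seq ax15 i | i : 'I_n]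
  ++ [seq ax16 i | i : 'I_n]
  ++ [:: ax17; ax18].

End Equations.

Section Concrete.
Variables (n : nat) (X : Type).

(* X^(n+1), a tuple (x_1, ..., x_(n+1)) being split as ((x_1, ..., x_n), x_(n+1)) *)
Definition graph : Type := set (('I_n -> X) * X).

Definition partial_function (f : graph) : Prop :=
  forall x y z, f (x, y) -> f (x, z) -> y = z.

Definition injective_graph (f : graph) : Prop :=
  forall x y z, f (x, z) -> f (y, z) -> x = y.

Variable E : X -> X -> Prop.

Definition equivalent_entries (f : graph) : Prop :=
  forall x y, f (x, y) ->
    (forall i j, E (x i) (x j)) /\ (forall i, E (x i) y).

Definition graph_comp (f : 'I_n -> graph) (g : graph) : graph :=
  [set p | exists y : 'I_n -> X, (forall i, f i (p.1, y i)) /\ g (y, p.2)].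

Definition graph_anti (i : 'I_n) (f : graph) : graph :=
  [set p | p.2 = p.1 i /\ (forall j k, E (p.1 j) (p.1 k)) /\
           ~ exists y, f (p.1, y)].

Definition graph_pref (f g : graph) : graph :=
  [set p | f p \/ (~ (exists y, f (p.1, y)) /\ g p)].

(* The concrete operations, on arbitrary subsets of X^(n+1). *)
Definition graph_alg : alg n :=
  @Alg n graph graph_comp graph_anti (@setI _) graph_pref (inhabits set0).

Definition pfun_algebra (S : subuniverse graph_alg) : Prop :=
  Equivalence E /\
  forall f, S f -> partial_function f /\ equivalent_entries f.

End Concrete.

Definition injectively_representable (n : nat) (A : alg n) : Prop :=
  exists (X : Type) (E : X -> X -> Prop) (S : subuniverse (graph_alg n E)),
    pfun_algebra S /\ (forall f, S f -> injective_graph f) /\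
    isomorphic A (sub_alg S).

(* Main.v *)
From mathcomp Require Import all_boot.
From mathcomp Require Import boolp classical_sets.
From Stdlib Require List.
From Stdlib Require Import RelationClasses.
Require Import Defs.

Set Implicit Arguments.
Unset Strict Implicit.
Unset Printing Implicit Defensive.

Local Open Scope classical_set_scope.
Local Open Scope alg_scope.

(** The equations are sound because both sides can be evaluated at one input x:
   antidomains, ties and preferential unions only ask which functions are
   defined at x and which outputs agree.  Injectivity enters in
   [graph_tie_inj] only.

   Conversely, let A satisfy the equations.  Write [off a x] for <A_1^n a> ; x,
   the part of x outside the domain of a, and [on a x] for <D_1^n a> ; x.  The
   operators [off a] satisfy the twisted law [off_off], but that they commute
   does not follow from the equations for composition and antidomain alone.  It
   is obtained from the quasi-identity [off_on_inj]: an element is determined by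
   its parts off a and on a.  To see this, consider the tie of x and y, which
   tests for being equal or both undefined.  If x and y agree off a and on a,
   each of the two parts of the tie is an antidomain of an element that vanishes
   there ([off_tie_eq]); the parts add up to a projection ([tie_eq]), and a tie
   that is a projection forces x = y.  From then on, [on a] and [off a] behave
   like multiplication by complementary elements of a Boolean algebra: they
   commute, and off a c = 0 says that the domain of c is part of that of a.

   An ultrafilter U of domains, regarded as a set of elements, is an ideal
   input.  The base of the representation consists of the germs at all U: the
   elements of U modulo the relation that the meet of x and y is in U.  Germs
   are E-equivalent when they are germs at the same U, and f acts by composition
   on the right, sending the germs of a_1, ..., a_n to the germ of
   <a_1, ..., a_n> ; f if this element is in U.  The action is well defined
   ([agree_comp]) and injective ([agree_inj]) and respects the operations.  It
   is faithful: if x and y are distinct, some tie of them is not a projection,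
   and an ultrafilter that avoids this tie contains x or y but not their meet
   ([ultra_separates]), so that x and y differ at the germs of the projections.

   The variety property follows, as validity of equations passes to homomorphic
   images, subalgebras and products. *)

(** * Equations and valuations *)

Lemma Forall_image (I : finType) (T : Type) (P : T -> Prop) (f : I -> T) :
  List.Forall P [seq f i | i : I] <-> forall i, P (f i).
Proof.
rewrite /image_mem; split=> [H i | H]; last first.
  by elim: (enum I) => [|i s IHs] /=; constructor.
have: i \in enum I by rewrite mem_enum.
elim: (enum I) H => //= j s IHs H.
have [Pj Hs] := proj1 (List.Forall_cons_iff _ _ _) H.
by rewrite inE => /predU1P [-> //|]; apply: IHs.
Qed.

(** Lets the long list of equations be destructed and proved one by one, for
   any property of equations. *)
Lemma axiomsP (n : nat) (P : equation n -> Prop) :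
  List.Forall P (axioms n) <->
  [/\ [/\ P (ax1 n), P (ax2 n), P (ax3 n) & forall i : 'I_n, P (ax4 i)],
      [/\ P (ax5 n), forall i : 'I_n, P (ax6 i), P (ax7 n)
        & forall i j k : 'I_n, P (ax8 i j k)],
      [/\ P (ax9 n), P (ax10 n), P (ax11 n), P (ax12 n) & P (ax13 n)],
      [/\ forall i : 'I_n, P (ax14 i), forall i : 'I_n, P (ax15 i)
        & forall i : 'I_n, P (ax16 i)]
    & P (ax17 n) /\ P (ax18 n)].
Proof.
rewrite /axioms.
rewrite ?(List.Forall_app, List.Forall_cons_iff, Forall_image).
split.
  move=> [P1 [P2 [P3 [P4 [P5 [P6 [P7 [P8 [P9 [P10 [P11 [P12 [P13]]]]]]]]]]]]].
  move=> [P14 [P15 [P16 [P17 [P18 _]]]]]; split=> //; split=> //.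
  by move=> i j k; apply: (P8 (i, j, k)).
move=> [[P1 P2 P3 P4] [P5 P6 P7 P8] [P9 P10 P11 P12 P13]].
move=> [P14 P15 P16] [P17 P18].
by do 18!split=> //; constructor.
Qed.

Lemma eval_hom (n : nat) (A B : alg n) (h : A -> B) (v : nat -> A) t :
  is_hom h -> h (eval v t) = eval (h \o v) t.
Proof.
case=> hc ha hm hp.
elim: t => //= [s IHs u IHu|i s IHs|s IHs u IHu|s IHs u IHu].
- by rewrite hc IHu; congr (_ ;; _); apply/funext.
- by rewrite ha IHs.
- by rewrite hm IHs IHu.
- by rewrite hp IHs IHu.
Qed.

(** Terms form an algebra, so facts about homomorphisms such as [hom_restr]
   evaluate the recursively defined terms, which do not reduce by themselves. *)
Lemma eval_is_hom (n : nat) (A : alg n) (v : nat -> A) :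
  @is_hom n (term_alg n) A (eval v).
Proof. by []. Qed.

Lemma hom_restr (n : nat) (A B : alg n) (h : A -> B) (a : 'I_n -> A) b :
  is_hom h -> h (restr a b) = restr (h \o a) (h b).
Proof.
case=> hc ha _ _; rewrite /restr; elim: (enum 'I_n) => //= j s IHs.
by rewrite hc IHs; congr (_ ;; _); apply/funext=> k; rewrite /doms /dom !ha.
Qed.

Lemma models_pullback (n : nat) (A B : alg n) (h : A -> B) es :
  is_hom h -> injective h -> models B es -> models A es.
Proof.
move=> hh hi; apply: List.Forall_impl => e Be v.
by apply: hi; rewrite !(eval_hom v _ hh).
Qed.

Lemma models_is_variety (n : nat) (es : seq (equation n)) :
  is_variety (fun A : alg n => models A es).
Proof.
split.
- move=> A B h hh hs; apply: List.Forall_impl => e Ae v.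
  have [u hu] := choice (fun k => hs (v k)).
  have -> : v = h \o u by apply/funext=> k; rewrite /= hu.
  by rewrite -!(eval_hom u _ hh) Ae.
- move=> A S; apply: (@models_pullback _ (sub_alg S) A sval) => //.
  by move=> [a Sa] [b Sb] /= ab; subst b; congr exist.
- move=> I A MA; apply/List.Forall_forall => e ese v.
  apply: functional_extensionality_dep => k.
  have pk : is_hom (fun f : prod_alg A => f k) by [].
  rewrite !(eval_hom v _ pk).
  by have /List.Forall_forall/(_ e ese) := MA k; apply.
Qed.

(** The variables of the equations are pairwise distinct, so that they can be
   instantiated independently. *)
Lemma valuation_ex (n : nat) (A : alg n) (a b c d z : A)
    (aa bb cc : 'I_n -> A) :
  exists v : nat -> A,
    [/\ v 0 = a, v 1 = b, v 2 = c, v 3 = d & v 4 = z] /\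
    [/\ (fun i : 'I_n => v (5 + 3 * i)) = aa,
        (fun i : 'I_n => v (6 + 3 * i)) = bb
      & (fun i : 'I_n => v (7 + 3 * i)) = cc].
Proof.
pose v k := if k < 5 then nth a [:: a; b; c; d; z] k else
  if insub ((k - 5) %/ 3) is Some i
  then nth (cc i) [:: aa i; bb i] ((k - 5) %% 3) else a.
have vE (r : nat) (i : 'I_n) : r < 3 ->
    v (5 + r + 3 * i) = nth (cc i) [:: aa i; bb i] r.
  move=> r3; rewrite /v -addnA ltnNge leq_addr /= addKn addnC mulnC.
  rewrite divnMDl // divn_small // addn0 insubT // => ilt.
  rewrite modnMDl modn_small //.
  by congr (nth (cc _) [:: aa _; bb _] r); apply: val_inj.
exists v; split=> //; split; apply/funext=> i.
- exact: (vE 0).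
- exact: (vE 1).
- exact: (vE 2).
Qed.

Corollary valuation_elts (n : nat) (A : alg n) (a b c d : A) :
  exists v : nat -> A, [/\ v 0 = a, v 1 = b, v 2 = c & v 3 = d].
Proof.
have k (_ : 'I_n) := a.
by have [v [[? ? ? ? _] _]] := valuation_ex a b c d a k k k; exists v.
Qed.

(** * Soundness: the equations hold for injective partial functions *)

Section Graphs.
Variables (n : nat) (X : Type) (E : X -> X -> Prop) (i0 : 'I_n).
Local Notation GA := (graph_alg n E).
Implicit Types (f g a b c : GA) (x : 'I_n -> X) (y z : X) (i j k : 'I_n).

(** The inputs at which an operation may be defined: the antidomains test
   definedness inside a single block of E only. *)
Definition cluster x : Prop := forall i j, E (x i) (x j).
Definition defined f x : Prop := exists y, f (x, y).

Lemma graphP f g : (forall x y, f (x, y) <-> g (x, y)) -> f = g.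
Proof. by move=> fg; apply/predeqP=> -[x y]. Qed.

(** Composition on the left with restricted projections is restriction.  The
   index [i0] witnesses n > 0: without any projection, [Q] could not be read off
   the tuple [t]. *)
Lemma test_comp (t : 'I_n -> GA) (Q : ('I_n -> X) -> Prop) g x y :
  (forall i x y, t i (x, y) <-> y = x i /\ Q x) ->
  (t ;; g) (x, y) <-> Q x /\ g (x, y).
Proof.
move=> tQ; split=> [[z /= [xz zy]]|[Qx xy]].
  have -> : x = z by apply/funext=> i; have /tQ [] := xz i.
  split=> //; have /tQ [_] := xz i0; congr Q.
  by apply/funext=> i; have /tQ [] := xz i.
by exists x; split=> // i; apply/tQ.
Qed.

Lemma antiE i f x y :
  anti i f (x, y) <-> y = x i /\ cluster x /\ ~ defined f x.
Proof. by []. Qed.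

Lemma antis_comp f g x y :
  (antis f ;; g) (x, y) <-> (cluster x /\ ~ defined f x) /\ g (x, y).
Proof. by apply: (test_comp (Q := fun x => cluster x /\ ~ defined f x)). Qed.

Lemma defined_anti i f x : defined (anti i f) x <-> cluster x /\ ~ defined f x.
Proof. by split=> [[y] /antiE []|fx]; last by exists (x i). Qed.

Lemma domE i f x y :
  dom i f (x, y) <-> y = x i /\ cluster x /\ defined f x.
Proof.
rewrite /dom antiE defined_anti.
split=> [[-> [cx ndf]]|[-> [cx df]]]; split=> //; split=> //.
  by apply: contrapT => nf; apply: ndf.
by case.
Qed.

Lemma doms_comp f g x y :
  (doms f ;; g) (x, y) <-> (cluster x /\ defined f x) /\ g (x, y).
Proof.
apply: (test_comp (Q := fun x => cluster x /\ defined f x)) => *.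
exact: domE.
Qed.

Lemma defined_dom i f x : defined (dom i f) x <-> cluster x /\ defined f x.
Proof. by split=> [[z /domE []]|fx] //; exists (x i); apply/domE. Qed.

Lemma defined_off f g x : defined (antis f ;; g) x <->
  (cluster x /\ ~ defined f x) /\ defined g x.
Proof.
by split=> [[y /antis_comp [fx gx]]|[fx [y gx]]];
  [split=> //; exists y | exists y; apply/antis_comp].
Qed.

Lemma defined_on f g x : defined (doms f ;; g) x <->
  (cluster x /\ defined f x) /\ defined g x.
Proof.
by split=> [[y /doms_comp [fx gx]]|[fx [y gx]]];
  [split=> //; exists y | exists y; apply/doms_comp].
Qed.

Lemma plusE i f g x y :
  plus i f g (x, y) <-> y = x i /\ cluster x /\ (defined f x \/ defined g x).
Proof.
rewrite /plus antiE defined_off defined_anti.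
by case: (pselect (defined f x)); case: (pselect (defined g x)); tauto.
Qed.

(** A tie is the projection restricted to the inputs where [f] and [g] agree or
   are both undefined. *)
Lemma tieE i f g x y :
  tie i f g (x, y) <-> y = x i /\ cluster x /\
    (defined (f ** g) x \/ ~ defined f x /\ ~ defined g x).
Proof. by rewrite /tie plusE defined_dom defined_off defined_anti; tauto. Qed.

Lemma defined_tie i f g x : defined (tie i f g) x <->
  cluster x /\ (defined (f ** g) x \/ ~ defined f x /\ ~ defined g x).
Proof. by split=> [[z /tieE []]|fx] //; exists (x i); apply/tieE. Qed.

Lemma zero_empty f p : ~ zero f p.
Proof. by case: p => x y /antis_comp [[_ nf] xy]; apply: nf; exists y. Qed.

Hypothesis E_equiv : Equivalence E.

Definition proper f : Prop :=
  [/\ partial_function f, equivalent_entries E f & injective_graph f].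

Section Sound.
Variable v : nat -> GA.
Hypothesis v_proper : forall k : nat, proper (v k).

Lemma proper_cluster f x y : proper f -> f (x, y) -> cluster x.
Proof. by case=> _ fE _ /fE []. Qed.

Lemma proper_fun f x y z : proper f -> f (x, y) -> f (x, z) -> y = z.
Proof. by case=> ff _ _; apply: ff. Qed.

Lemma restr_graph (aa : 'I_n -> GA) f x y : proper f ->
  restr aa f (x, y) <-> (forall i, defined (aa i) x) /\ f (x, y).
Proof.
move=> fP; pose R s : GA := foldr (fun j t => doms (aa j) ;; t) f s.
have RS j s : R (j :: s) = doms (aa j) ;; R s by [].
suff H s : R s (x, y) <->
    (forall i, i \in s -> defined (aa i) x) /\ f (x, y).
  have {H} -> : restr aa f (x, y) <-> _ := H (enum 'I_n).
  by split=> -[Ha Ux]; split=> // i *; apply: Ha; rewrite ?mem_enum.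
elim: s => [|j s IHs]; first by split=> [|[]].
rewrite RS doms_comp IHs; split=> [[[_ dj] [ds fxy]]|[ds fxy]].
  by split=> // i; rewrite inE => /predU1P [->|/ds].
split; first by split; [apply: proper_cluster fxy | apply/ds/mem_head].
by split=> // i si; apply: ds; rewrite inE si orbT.
Qed.

(** The left side chooses an intermediate tuple for every [bb i] separately;
   functionality of the [aa j] makes the choices coincide. *)
Lemma graph_compA (aa bb : 'I_n -> GA) c : (forall i, proper (aa i)) ->
  (fun i => aa ;; bb i) ;; c = aa ;; bb ;; c.
Proof.
move=> aP; apply: graphP => x y; split.
  move=> [z /= [xz zy]]; have [u xu] := choice xz.
  exists (u i0); split=> /= [i|]; first by have [] := xu i0.
  exists z; split=> //= i; have [xui uz] := xu i.
  suff -> : u i0 = u i by [].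
  by apply/funext=> j; apply: (proper_fun (aP j)) (proj1 (xu i0) j) (xui j).
move=> [u /= [xu [z /= [uz zy]]]]; exists z; split=> //= i.
by exists u.
Qed.

(** Both sides pick the output of [aa i] at the inputs where all [aa j] are
   defined and [aa ;; b] is not.  That the outputs lie in one block follows from
   each of them lying in the block of the input. *)
Lemma graph_comp_anti (aa : 'I_n -> GA) b i : (forall i, proper (aa i)) ->
  aa ;; anti i b = antis (aa ;; b) ;; restr aa (aa i).
Proof.
move=> aP; apply: graphP => x y; rewrite antis_comp restr_graph //; split.
  move=> [z /= [xz /antiE [-> [cz nbz]]]]; split.
    split; first exact: proper_cluster (xz i).
    move=> [w [u /= [xu uw]]]; apply: nbz; exists w.
    have -> // : z = u.
    by apply/funext=> j; apply: (proper_fun (aP j)) (xz j) (xu j).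
  by split=> // j; exists (z j).
move=> [[cx nab] [dax xy]]; have [z xz] := choice dax.
exists z; split=> //=; apply/antiE; split.
  exact: (proper_fun (aP i) xy (xz i)).
split; last by move=> [w zw]; apply: nab; exists w; exists z.
move=> j k; have [_ aE _] := aP j; have [_ aE' _] := aP k.
have [_ /(_ i0) xj] := aE _ _ (xz j); have [_ /(_ i0) xk] := aE' _ _ (xz k).
by transitivity (x i0) => //; symmetry.
Qed.

Lemma graph_comp_meet (aa : 'I_n -> GA) b c : (forall i, proper (aa i)) ->
  aa ;; (b ** c) = (aa ;; b) ** (aa ;; c).
Proof.
move=> aP; apply: graphP => x y; split.
  by move=> [z /= [xz [bz cz]]]; split; exists z.
move=> [[z /= [xz zb]] [u /= [xu uc]]].
have zu : z = u by apply/funext=> j; apply: (proper_fun (aP j)) (xz j) (xu j).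
by exists z; split=> //; split=> //; rewrite zu.
Qed.

Lemma ties_graph a b c x y : (ties a b ;; c) (x, y) <->
  (cluster x /\ (defined (a ** b) x \/ ~ defined a x /\ ~ defined b x)) /\
  c (x, y).
Proof.
apply: (test_comp (Q := fun x => cluster x /\
  (defined (a ** b) x \/ ~ defined a x /\ ~ defined b x))) => i x' y'.
exact: tieE.
Qed.

Lemma graph_ties_comp a b : proper a -> proper b ->
  ties a b ;; a = ties a b ;; b.
Proof.
move=> aP bP; apply: graphP => x y; rewrite !ties_graph; split.
  move=> [[cx [[z [xz xz']]|[na nb]]] xy]; last by case: na; exists y.
  split; first by split=> //; left; exists z.
  by rewrite (proper_fun aP xy xz).
move=> [[cx [[z [xz xz']]|[na nb]]] xy]; last by case: nb; exists y.
split; first by split=> //; left; exists z.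
by rewrite (proper_fun bP xy xz').
Qed.

Lemma graph_off_tie i d a b : 
  plus i (antis d ;; dom i (antis d ;; (a ** b)))
         (antis d ;; antis (antis d ;; a) ;; anti i (antis d ;; b))
  = antis d ;; tie i a b :> GA.
Proof.
apply: graphP => x y; rewrite plusE antis_comp tieE.
rewrite !(defined_off, defined_dom, defined_anti).
by case: (pselect (defined d x)); case: (pselect (defined a x)); tauto.
Qed.

Lemma graph_tie_split i a b c :
  plus i (doms a ;; tie i b c) (antis a ;; tie i b c) = tie i b c :> GA.
Proof.
apply: graphP => x y; rewrite plusE defined_on defined_off tieE defined_tie.
by case: (pselect (defined a x)); tauto.
Qed.

Lemma graph_tie_inj i a (bb cc : 'I_n -> GA) p :
  (forall i, proper (bb i)) -> (forall i, proper (cc i)) -> proper a ->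
  ~ (doms ((bb ;; a) ** (cc ;; a)) ;; anti i (tie i (bb i) (cc i))) p.
Proof.
case: p => x y bP cP [_ _ a_inj] /doms_comp [[cx [w]]].
move=> [[z /= [xz zw]] [u /= [xu uw]]] /antiE [_ [_]]; apply.
apply/defined_tie; split=> //; left; exists (z i); split; first exact: xz.
by rewrite (a_inj _ _ _ zw uw); apply: xu.
Qed.

Lemma graph_on_pref a b : proper a -> doms a ;; (a |_| b) = a.
Proof.
move=> aP; apply: graphP => x y; rewrite doms_comp; split.
  by move=> [[_ da] [//|[nda _]]]; case: nda.
move=> xy; split; last by left.
by split; [apply: proper_cluster xy | exists y].
Qed.

Lemma graph_off_pref a b : antis a ;; (a |_| b) = antis a ;; b :> GA.
Proof.
apply: graphP => x y; rewrite !antis_comp; split=> -[[cx nda] xy]; split=> //.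
  by case: xy => [xy|[]] //; case: nda; exists y.
by right.
Qed.

Lemma graph_on_meet a b : proper a -> doms (a ** b) ;; a = a ** b.
Proof.
move=> aP; apply: graphP => x y; rewrite doms_comp; split.
  by move=> [[cx [z [az bz]]] ay]; split=> //; rewrite (proper_fun aP ay az).
move=> [ay byy]; split=> //; split; first exact: proper_cluster ay.
by exists y.
Qed.

Lemma graph_on_self a : proper a -> doms a ;; a = a.
Proof.
move=> aP; apply: graphP => x y; rewrite doms_comp; split=> [[]//|xy].
by split=> //; split; [apply: proper_cluster xy | exists y].
Qed.

Lemma graph_antiA i j k a : anti i (anti j a) = anti i (anti k a).
Proof. by apply: graphP => x y; rewrite !antiE !defined_anti. Qed.

Lemma graph_proj_comp (z a : GA) : proper a -> proj z ;; a = a.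
Proof.
move=> aP; rewrite -[proj z]/(antis (zero z)).
apply: graphP => x y; rewrite antis_comp.
split=> [[]//|xy]; split=> //; split; first exact: proper_cluster xy.
by move=> [w /zero_empty].
Qed.

Lemma graph_zeroP (f z : GA) : (forall p, ~ f p) -> f = zero z.
Proof. by move=> f0; apply/predeqP=> p; split=> [/f0|/zero_empty]. Qed.

Lemma axioms_sound :
  List.Forall (fun e => eval v (lhs e) = eval v (rhs e)) (axioms n).
Proof.
apply/axiomsP; split.
- split.
  + apply: graph_compA => *; exact: v_proper.
  + apply: graph_proj_comp => *; exact: v_proper.
  + exact/graph_zeroP/zero_empty.
  + move=> i; apply: graph_zeroP => -[x y] [z /= [/(_ i)]].
    by rewrite eqxx => /zero_empty.
- split.
  + by apply: graph_zeroP => -[x y] [z /= [_]] /zero_empty.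
  + move=> i; rewrite /= (hom_restr _ _ (eval_is_hom v)).
    apply: graph_comp_anti => *; exact: v_proper.
  + apply: graph_on_self => *; exact: v_proper.
  + by move=> i j k; apply: graph_antiA.
- split.
  + exact: setIid.
  + exact: setIC.
  + apply: graph_comp_meet => *; exact: v_proper.
  + apply: graph_on_meet => *; exact: v_proper.
  + apply: graph_ties_comp => *; exact: v_proper.
- split.
  + by move=> i; apply: graph_off_tie.
  + by move=> i; apply: graph_tie_split.
  + move=> i; apply: graph_zeroP => p.
    by apply: graph_tie_inj => *; exact: v_proper.
- split.
  + apply: graph_on_pref => *; exact: v_proper.
  + exact: graph_off_pref.
Qed.

End Sound.
End Graphs.

Lemma representable_models (n : nat) (A : alg n) : 0 < n ->
  injectively_representable A -> models A (axioms n).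
Proof.
move=> n0 [X [E [S [[Eeq Sp] [Si [h [hh [g hg _]]]]]]]].
pose f (a : A) : graph_alg n E := sval (h a).
have fh : @is_hom n A (graph_alg n E) f.
  by case: hh => hc ha hm hp; split=> *; rewrite /f ?hc ?ha ?hm ?hp.
have f_inj : injective f.
  move=> a b ab; apply: (can_inj hg); move: ab; rewrite /f.
  by case: (h a) (h b) => [x Sx] [y Sy] /= xy; subst y; congr exist.
have fP a : proper (f a).
  have Sfa : S (f a) := svalP (h a).
  by have [] := Sp _ Sfa; split=> //; apply: Si.
apply/List.Forall_forall => e ee v; apply: f_inj.
rewrite !(eval_hom v _ fh).
have /List.Forall_forall := axioms_sound (Ordinal n0) Eeq (fun k => fP (v k)).
exact.
Qed.

(** * The calculus of restrictions to domains and their complements *)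

Section Laws.
Variables (n : nat) (A : alg n).
Hypothesis M : models A (axioms n).
Implicit Types (a b c d x y z : A) (aa bb cc : 'I_n -> A) (i j k : 'I_n).

Definition bot : A := zero (inhabited_witness (alg_nonempty A)).
Definition off a x := antis a ;; x.
Definition on a x := doms a ;; x.

Lemma compA aa bb c : aa ;; bb ;; c = (fun i => aa ;; bb i) ;; c.
Proof.
have [v [[_ _ <- _ _] [<- <- _]]] := valuation_ex c c c c c aa bb bb.
by have/axiomsP [[P _ _ _] _ _ _ _] := M; symmetry; apply: (P v).
Qed.

Lemma proj_comp z a : proj z ;; a = a.
Proof.
have k (_ : 'I_n) := a.
have [v [[<- _ _ _ <-] _]] := valuation_ex a a a a z k k k.
by have/axiomsP [[_ P _ _] _ _ _ _] := M; apply: (P v).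
Qed.

Lemma zeroE a : zero a = bot.
Proof.
rewrite /bot; move: (inhabited_witness _) => b.
have [v [<- <- _ _]] := valuation_elts a b a a.
by have/axiomsP [[_ _ P _] _ _ _ _] := M; apply: (P v).
Qed.

Lemma off_self a : off a a = bot.
Proof. exact: zeroE. Qed.

Lemma comp_bot aa b i : aa i = bot -> aa ;; b = bot.
Proof.
move=> aai; rewrite -(zeroE b).
have [v [[_ <- _ _ Ez] [Ea _ _]]] := valuation_ex b b b b b aa aa aa.
have/axiomsP [[_ _ _ P] _ _ _ _] := M.
have PE : _ = zero (v 4) := P i v.
rewrite zeroE -(zeroE (v 4)) -PE /= -Ea; congr (_ ;; _); apply/funext=> j.
case: eqP => [->|] //=; rewrite -Ea in aai; rewrite aai.
exact/esym/(zeroE (v 4)).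
Qed.

Lemma comp0 aa : aa ;; bot = bot.
Proof.
rewrite -(zeroE bot).
have [v [[_ _ _ _ <-] [<- _ _]]] := valuation_ex bot bot bot bot bot aa aa aa.
by have/axiomsP [_ [P _ _ _] _ _ _] := M; apply: (P v).
Qed.

Lemma comp_anti aa b i :
  aa ;; anti i b = off (aa ;; b) (restr aa (aa i)).
Proof.
have [v [[_ <- _ _ _] [<- _ _]]] := valuation_ex b b b b b aa aa aa.
have/axiomsP [_ [_ P _ _] _ _ _] := M; rewrite [LHS](P i v) /=.
by rewrite (hom_restr _ _ (eval_is_hom v)).
Qed.

Lemma on_self a : on a a = a.
Proof.
have [v [<- _ _ _]] := valuation_elts a a a a.
by have/axiomsP [_ [_ _ P _] _ _ _] := M; apply: (P v).
Qed.

Lemma antiA i j k a : anti i (anti j a) = anti i (anti k a).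
Proof.
have [v [<- _ _ _]] := valuation_elts a a a a.
by have/axiomsP [_ [_ _ _ P] _ _ _] := M; apply: (P i j k v).
Qed.

Lemma meet_idem a : a ** a = a.
Proof.
have [v [<- _ _ _]] := valuation_elts a a a a.
by have/axiomsP [_ _ [P _ _ _ _] _ _] := M; apply: (P v).
Qed.

Lemma meetC a b : a ** b = b ** a.
Proof.
have [v [<- <- _ _]] := valuation_elts a b a a.
by have/axiomsP [_ _ [_ P _ _ _] _ _] := M; apply: (P v).
Qed.

Lemma comp_meet aa b c : aa ;; (b ** c) = (aa ;; b) ** (aa ;; c).
Proof.
have [v [[_ <- <- _ _] [<- _ _]]] := valuation_ex b b c b b aa aa aa.
by have/axiomsP [_ _ [_ _ P _ _] _ _] := M; apply: (P v).
Qed.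

Lemma on_meet a b : on (a ** b) a = a ** b.
Proof.
have [v [<- <- _ _]] := valuation_elts a b a a.
by have/axiomsP [_ _ [_ _ _ P _] _ _] := M; apply: (P v).
Qed.

Lemma ties_comp a b : ties a b ;; a = ties a b ;; b.
Proof.
have [v [<- <- _ _]] := valuation_elts a b a a.
by have/axiomsP [_ _ [_ _ _ _ P] _ _] := M; apply: (P v).
Qed.

Lemma off_tie i d a b :
  plus i (off d (dom i (off d (a ** b))))
         (off d (off (off d a) (anti i (off d b))))
  = off d (tie i a b).
Proof.
have [v [<- <- _ <-]] := valuation_elts a b a d.
by have/axiomsP [_ _ _ [P _ _] _] := M; apply: (P i v).
Qed.

Lemma tie_split i a b c :
  plus i (on a (tie i b c)) (off a (tie i b c)) = tie i b c.
Proof.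
have [v [<- <- <- _]] := valuation_elts a b c a.
by have/axiomsP [_ _ _ [_ P _] _] := M; apply: (P i v).
Qed.

Lemma tie_inj i a bb cc :
  on ((bb ;; a) ** (cc ;; a)) (anti i (tie i (bb i) (cc i))) = bot.
Proof.
rewrite -(zeroE a).
have [v [[<- _ _ _ E] [_ <- <-]]] := valuation_ex a a a a a bb bb cc.
by rewrite -{3}E; have/axiomsP [_ _ _ [_ _ P] _] := M; apply: (P i v).
Qed.

Lemma on_pref a b : on a (a |_| b) = a.
Proof.
have [v [<- <- _ _]] := valuation_elts a b a a.
by have/axiomsP [_ _ _ _ [P _]] := M; apply: (P v).
Qed.

Lemma off_pref a b : off a (a |_| b) = off a b.
Proof.
have [v [<- <- _ _]] := valuation_elts a b a a.
by have/axiomsP [_ _ _ _ [_ P]] := M; apply: (P v).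
Qed.

Lemma anti_bot i z : anti i bot = proj z i :> A.
Proof. by rewrite -(zeroE z). Qed.

Lemma off_bot x : off bot x = x.
Proof.
rewrite -[RHS](proj_comp bot); congr (_ ;; _); apply/funext=> i.
exact: anti_bot.
Qed.

Lemma off0 a : off a bot = bot.
Proof. exact: comp0. Qed.

Lemma doms_anti i a : doms a = antis (anti i a).
Proof. by apply/funext=> j; apply: antiA. Qed.

Lemma onE i a x : on a x = off (anti i a) x.
Proof. by rewrite /on (doms_anti i). Qed.

Lemma doms_antiC i j a : doms (anti i a) = doms (anti j a).
Proof. by apply/funext=> k; rewrite /doms /dom (antiA k i j). Qed.

(** The projections and domain restrictions in [comp_anti] are absorbed when the
   tuple consists of antidomains. *)
Lemma off_anti a b i : off a (anti i b) = off (off a b) (anti i a).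
Proof.
rewrite [LHS]comp_anti; congr off; rewrite /restr.
elim: (enum 'I_n) => //= j s ->.
by rewrite /antis (doms_antiC j i); apply: on_self.
Qed.

(** The twisted law: a restriction off [b] made before one off [a] can be made
   after it, once [b] itself is restricted off [a]. *)
Lemma off_off a b x : off a (off b x) = off (off a b) (off a x).
Proof.
rewrite /off !compA; congr (_ ;; _); apply/funext=> i; exact: off_anti.
Qed.

(* A fixed index makes [on a] equal to [off b] for [b := anti i0 a], so that
   laws of [off] transfer to [on]. *)
Variable i0 : 'I_n.

Lemma on_off a x : on a (off a x) = bot.
Proof.
by rewrite (onE i0) /off compA; apply: (@comp_bot _ _ i0); apply: off_self.
Qed.

Lemma off_anti_self i a : off a (anti i a) = anti i a.
Proof. by rewrite off_anti off_self off_bot. Qed.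

Lemma off_on a x : off a (on a x) = bot.
Proof.
by rewrite (onE i0) off_off off_anti_self -onE on_off.
Qed.

(** Triple antidomains collapse.  Restricting [off a y] to the domain of
   [anti i a] changes nothing as [on_self] fixes each [anti k a]; by the twisted
   law, it also amounts to restricting [y] to the domain of [anti i a], because
   [a] vanishes there. *)
Lemma on_anti i a x : on (anti i a) x = off a x.
Proof.
have on_antis y : on (anti i a) (off a y) = off a y.
  rewrite /off /on compA; congr (_ ;; _); apply/funext=> k.
  by rewrite (doms_antiC i k); apply: on_self.
rewrite -[RHS]on_antis !(onE i (anti i a)) off_off.
have -> : off (anti i (anti i a)) a = bot.
  by rewrite -onE -{2}(on_self a) (onE i a) on_off.
by rewrite off_bot.
Qed.

Lemma off_proj i a : off a (anti i bot) = anti i a.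
Proof. by rewrite off_anti off0 off_bot. Qed.

Lemma anti3 i a : anti i (anti i (anti i a)) = anti i a.
Proof. by rewrite -off_proj -onE on_anti off_proj. Qed.

Lemma offK a x : off a (off a x) = off a x.
Proof. by rewrite off_off off_self off_bot. Qed.

Lemma onK a x : on a (on a x) = on a x.
Proof. by rewrite !(onE i0) offK. Qed.

Lemma off_off_off a b x : off a (off b (off a x)) = off a (off b x).
Proof. by rewrite off_off offK -off_off. Qed.

Lemma on0 a : on a bot = bot.
Proof. exact: comp0. Qed.

(** If [x] and [y] agree off [d], their tie should be the full projection there;
   at this stage it is only seen to be an antidomain whose argument vanishes off
   [d].  All tests in the computation are built from [d] and [off d x], and for
   these the twisted law suffices to commute restrictions. *)
Lemma off_tie_eq i d x y : off d x = off d y ->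
  exists2 m, off d m = bot & off d (tie i x y) = anti i m.
Proof.
move=> xy; set w := off d x; set v := off d (anti i w).
have dw : off d w = w by apply: offK.
have dxy : off d (x ** y) = w.
  by rewrite [LHS]comp_meet -/(off d x) -/(off d y) -xy meet_idem.
set r := off v (anti i d).
have dDw : off d (dom i w) = r by rewrite /dom off_anti -/v.
have dv : off d v = v by apply: offK.
have dAv : off d (anti i v) = r by rewrite off_anti dv.
have dr : off d r = r by rewrite /r off_off dv off_anti_self.
exists (off r (anti i v)); first by rewrite off_off dr dAv off_self.
rewrite -off_tie dxy dDw -xy -/w.
by rewrite off_anti_self.
Qed.

(** Applied to [a] and to [anti i a], the previous lemma gives arguments [m] and
   [m'] that vanish off and on [a]; their domains are disjoint, which is what
   makes the sum of the two halves of the tie equal to the projection. *)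
Lemma tie_eq i a x y : off a x = off a y -> on a x = on a y ->
  tie i x y = proj bot i.
Proof.
move=> offxy; rewrite !(onE i) => onxy.
have [m am tm] := off_tie_eq i offxy.
have [m' am' tm'] := off_tie_eq i onxy.
rewrite -(tie_split i a) tm (onE i) tm' /plus -/(off _ _) -onE -(anti_bot).
congr anti.
have offa b p j : off b p = bot -> off b (dom j p) = bot.
  by move=> bp; rewrite off_anti (off_anti _ p) bp off_bot off_self.
have on_m'a : on m' a = bot.
  (* Insert a further restriction to the domain of [m'] inside: restriction to
     the domain of [a] sends each [dom j m'] to 0. *)
  rewrite -(on_self a) (onE i a) (onE i m') -off_off_off -(onE i m' a).
  rewrite {2}/off {1}/on compA (@comp_bot _ _ i) ?off0 //.
  exact: offa.
transitivity (on m' (off a (dom i m))); last by rewrite offa // on0.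
by rewrite !(onE i m') off_off -(onE i m' a) on_m'a off_bot.
Qed.

(** The quasi-identity that recovers an element from its two parts.  It reduces
   the commutation of restrictions to a check on each part. *)
Lemma off_on_inj a x y : off a x = off a y -> on a x = on a y -> x = y.
Proof.
move=> offxy onxy; have := ties_comp x y.
have -> : ties x y = proj bot by apply/funext=> i; apply: (tie_eq i offxy).
by rewrite !proj_comp.
Qed.

Lemma on_off_on a b x : on a (off b (on a x)) = on a (off b x).
Proof. by rewrite !(onE i0 a) off_off_off. Qed.

Lemma offC a b x : off a (off b x) = off b (off a x).
Proof.
apply: (@off_on_inj a); first by rewrite offK off_off_off.
by rewrite on_off -on_off_on on_off off0 on0.
Qed.

Lemma on_offC a b x : on a (off b x) = off b (on a x).
Proof. by rewrite !(onE i0 a) offC. Qed.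

Lemma onC a b x : on a (on b x) = on b (on a x).
Proof. by rewrite !(onE i0) offC. Qed.

Lemma off_eq0 a x : off a x = bot -> on a x = x.
Proof.
by move=> ax; apply: (@off_on_inj a); rewrite ?onK // off_on.
Qed.

(** From here on, [off b c = bot] is read as the inclusion of the domain of [c]
   in that of [b]; the following lemmas are the order axioms for filters. *)
Lemma off_trans c b x : off b c = bot -> off c x = bot -> off b x = bot.
Proof.
by move=> bc cx; rewrite -(off_bot (off b x)) -bc -off_off cx off0.
Qed.

Lemma off_on_self a x : off x (on a x) = bot.
Proof. by rewrite -on_offC off_self on0. Qed.

Lemma off_on0 c d x : off c x = bot -> off d x = bot -> off (on c d) x = bot.
Proof.
move=> cx dx; rewrite -(off_eq0 cx) (onE i0 c x) (onE i0 c d) -off_off dx off0.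
by [].
Qed.

Lemma restr_comp aa bb c : restr aa (bb ;; c) = (fun i => restr aa (bb i)) ;; c.
Proof.
by rewrite /restr; elim: (enum 'I_n) => //= j s ->; rewrite compA.
Qed.

Lemma restr_meet aa x y : restr aa (x ** y) = restr aa x ** restr aa y.
Proof.
by rewrite /restr; elim: (enum 'I_n) => //= j s ->; rewrite comp_meet.
Qed.

(** All domain restrictions in [restr] commute, so a further restriction to one
   of the [aa i] is absorbed wherever it is inserted. *)
Lemma restr_on aa i x : restr aa (on (aa i) x) = restr aa x.
Proof.
rewrite /restr; have: i \in enum 'I_n by rewrite mem_enum.
have on_foldr s : foldr (fun j t => doms (aa j) ;; t) (on (aa i) x) s =
    on (aa i) (foldr (fun j t => doms (aa j) ;; t) x s).
  by elim: s => //= j s ->; apply: onC.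
elim: (enum 'I_n) => //= j s IHs; rewrite inE => /predU1P [<-|/IHs -> //].
by rewrite on_foldr; apply: onK.
Qed.

Lemma on_meet_eq x y : on (x ** y) x = on (x ** y) y.
Proof. by rewrite on_meet [in RHS]meetC on_meet meetC. Qed.

(** * Ultrafilters of domains *)

(** A proper, possibly empty, filter of the Boolean algebra of domains, encoded
   as the set of the elements whose domain belongs to it. *)
Record dfilter (U : set A) : Prop := DFilter {
  dfilter0 : ~ U bot;
  dfilter_on : forall a b, U a -> U b -> U (on a b);
  dfilter_up : forall a b, off b a = bot -> U a -> U b }.

Record ultra (U : set A) : Prop := Ultra {
  ultra_dfilter :> dfilter U;
  ultra_dec : forall i a, U a \/ U (anti i a) }.

Lemma dfilter_principal u : u <> bot -> dfilter [set c | off c u = bot].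
Proof.
move=> u0; split=> [/= | a b /= | a b /=]; first by rewrite off_bot.
- exact: off_on0.
- exact: off_trans.
Qed.

(** The filter generated by [U] and [a]. *)
Lemma dfilter_extend U a : dfilter U -> (forall m, U m -> on a m <> bot) ->
  dfilter [set c | exists2 m, U m & off c (on a m) = bot].
Proof.
move=> [_ Uon _] aU; split=> [[m Um]|c d [x Ux cx] [y Uy dy]|c d dc [m Um cm]].
- by rewrite off_bot; apply: aU.
- exists (on x y); first exact: Uon.
  have mono p : off p (on x y) = bot -> off (on a p) (on a (on x y)) = bot.
    by move=> pxy; apply: off_on0; rewrite ?off_on // -on_offC pxy on0.
  apply: off_on0.
  + by apply: off_trans cx (mono _ _); rewrite off_on.
  + by apply: off_trans dy (mono _ _); rewrite off_on_self.
- by exists m => //; apply: off_trans dc cm.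
Qed.

Lemma ultra_ex (u : A) : u <> bot -> exists2 U, ultra U & U u.
Proof.
move=> u0.
pose P (F : set A) := dfilter F /\ forall a, F a -> F u.
have [F FP tF|U [[UF Uu] Umax]] := @Zorn_bigcup A P.
  split; last first.
    by move=> a [X FX Xa]; exists X => //; apply: (proj2 (FP X FX)) Xa.
  split.
  - by move=> [X FX X0]; apply: (dfilter0 (proj1 (FP X FX))).
  - move=> a b [X FX Xa] [Y FY Yb].
    have [XY|YX] := tF X Y FX FY.
      by exists Y => //; apply: (dfilter_on (proj1 (FP Y FY))) => //; apply: XY.
    by exists X => //; apply: (dfilter_on (proj1 (FP X FX))) => //; apply: YX.
  - move=> a b ba [X FX Xa]; exists X => //.
    exact: (dfilter_up (proj1 (FP X FX)) ba).
(* The empty set satisfies [P], so that the union of the empty chain does; a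
   maximal element is nonempty as the principal filter of [u] is in [P]. *)
have {}Uu : U u.
  apply: contrapT => Unu.
  have U_empty a : ~ U a by move=> /Uu.
  apply: (Umax [set c | off c u = bot]); last first.
    by split; [apply: dfilter_principal | move=> _ _ /=; rewrite off_self].
  by split=> [a /U_empty//|/(_ u)]; rewrite /= off_self => /(_ erefl).
exists U => //; split=> // i a; apply: contrapT => /not_orP [Una UnAa].
apply: (Umax [set c | exists2 m, U m & off c (on a m) = bot]).
  split=> [m Um|/(_ a)]; first by exists m => //; apply: off_on_self.
  by move=> sub; apply/Una/sub; exists u => //; apply: off_on.
split; last by move=> _ _; exists u => //; apply: off_on_self.
apply: dfilter_extend => // m Um am.
by apply: UnAa; apply: dfilter_up UF _ _ _ Um; rewrite -onE.
Qed.

Section InUltra.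
Variables (U : set A).
Hypothesis UU : ultra U.

Lemma ultra0 : ~ U bot.
Proof. exact: dfilter0 UU. Qed.

Lemma ultra_on a x : U (on a x) <-> U a /\ U x.
Proof.
split=> [Uax|[Ua Ux]]; last exact: dfilter_on UU _ _ Ua Ux.
by split; apply: dfilter_up UU _ _ _ Uax; rewrite ?off_on ?off_on_self.
Qed.

Lemma ultra_anti i a : U (anti i a) <-> ~ U a.
Proof.
split=> [UAa Ua|]; last by have [] := ultra_dec UU i a.
apply: ultra0; rewrite -(on_off a (anti i a)) off_anti_self.
by apply/ultra_on.
Qed.

Lemma ultra_off a x : U (off a x) <-> ~ U a /\ U x.
Proof. by rewrite -(on_anti i0) ultra_on ultra_anti. Qed.

Lemma ultra_comp_arg aa b i : U (aa ;; b) -> U (aa i).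
Proof.
move=> Uab; apply: contrapT => Unai; apply: ultra0.
have [_ /(_ (conj Unai Uab))] := ultra_off (aa i) (aa ;; b).
have -> // : off (aa i) (aa ;; b) = bot.
by rewrite /off compA; apply: (@comp_bot _ _ i); apply: off_self.
Qed.

Lemma ultra_meetl x y : U (x ** y) -> U x.
Proof. by rewrite -on_meet => /ultra_on []. Qed.

Lemma ultra_meetr x y : U (x ** y) -> U y.
Proof. by rewrite meetC => /ultra_meetl. Qed.

(** [restr] intersects domains, and a filter is closed under the finitely many
   intersections needed. *)
Lemma ultra_restr aa x : U (restr aa x) <-> (forall i, U (aa i)) /\ U x.
Proof.
suff H s : U (foldr (fun j t => doms (aa j) ;; t) x s) <->
    (forall i, i \in s -> U (aa i)) /\ U x.
  rewrite [restr _ _]/(foldr _ _ _) H.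
  by split=> -[Ha Ux]; split=> // i *; apply: Ha; rewrite ?mem_enum.
elim: s => [|j s IHs] /=; first by split=> [Ux|[]].
rewrite -/(on _ _) ultra_on IHs; split=> [[Uj [Us Ux]]|[Us Ux]].
  by split=> // i; rewrite inE => /predU1P [->|/Us].
split; first by apply: Us; rewrite mem_head.
by split=> // i si; apply: Us; rewrite inE si orbT.
Qed.

(** The domain of [x ** y] is where [x] and [y] are defined and equal, so this
   says that they coincide near the ideal input [U]. *)
Definition agree x y := U (x ** y).

Lemma agree_refl x : agree x x <-> U x.
Proof. by rewrite /agree meet_idem. Qed.

Lemma agree_sym x y : agree x y -> agree y x.
Proof. by rewrite /agree meetC. Qed.

Lemma agree_on t x y : U t -> on t x = on t y -> U x -> agree x y.
Proof.
move=> Ut txy Ux; suff /ultra_on [] : U (on t (x ** y)) by [].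
by rewrite /on comp_meet -/(on t x) -/(on t y) -txy meet_idem; apply/ultra_on.
Qed.

Lemma agree_restr (t : 'I_n -> A) x y : (forall i, U (t i)) ->
  restr t x = restr t y -> U x -> agree x y.
Proof.
move=> Ut txy Ux; suff /ultra_restr [] : U (restr t (x ** y)) by [].
by rewrite restr_meet -txy meet_idem; apply/ultra_restr.
Qed.

Lemma agree_trans y x z : agree x y -> agree y z -> agree x z.
Proof.
move=> xy yz; have Ux := ultra_meetl xy.
suff : agree (on (y ** z) x) (on (y ** z) z).
  by rewrite /agree -[X in U X]comp_meet => /ultra_on [].
apply: (agree_on xy); last by apply/ultra_on.
by rewrite onC on_meet_eq onC [in LHS]on_meet_eq.
Qed.

(** Well-definedness of the action on germs: the tuples [aa] and [bb] coincide
   after restriction to the intersection of the domains of the [aa i ** bb i],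
   which is in [U], and the restriction passes through the composition. *)
Lemma agree_comp aa bb c : (forall i, agree (aa i) (bb i)) ->
  U (aa ;; c) -> agree (aa ;; c) (bb ;; c).
Proof.
move=> ab; apply: (agree_restr ab); rewrite !restr_comp.
congr (_ ;; _); apply/funext=> i.
by rewrite -(restr_on _ i (aa i)) on_meet_eq restr_on.
Qed.

Lemma agree_off a x : U (off a x) -> agree (off a x) x.
Proof.
move=> Uax; have [Una Ux] := proj1 (ultra_off a x) Uax.
by apply: (@agree_on (anti i0 a)); rewrite ?ultra_anti // !on_anti offK.
Qed.

Lemma agree_on_self a x : U (on a x) -> agree (on a x) x.
Proof. by rewrite (onE i0) => /agree_off. Qed.

Lemma agree_meetl x y : agree x y -> agree (x ** y) x.
Proof. by rewrite /agree -{1 2}(on_meet x y); apply: agree_on_self. Qed.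

Lemma agree_restr_self aa x : U (restr aa x) -> agree (restr aa x) x.
Proof.
rewrite /restr; elim: (enum 'I_n) => [|j s IHs] /=; first by rewrite agree_refl.
rewrite -/(on _ _) => /[dup] /agree_on_self ts /ultra_on [_ /IHs].
exact: agree_trans.
Qed.

(** [U] evaluates a tie as an actual input would. *)
Lemma ultra_tie i x y : U (tie i x y) <-> U (x ** y) \/ ~ U x /\ ~ U y.
Proof.
rewrite /tie /plus -/(off _ _) -/(off _ _).
rewrite !(ultra_anti, ultra_off).
case: (pselect (U (x ** y))); case: (pselect (U x)); case: (pselect (U y));
  tauto.
Qed.

(** Injectivity of the action on germs: [tie_inj] puts the tie of [aa i] and
   [bb i] in [U], and both are defined there, so they must agree. *)
Lemma agree_inj f aa bb : agree (aa ;; f) (bb ;; f) ->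
  forall i, agree (aa i) (bb i).
Proof.
move=> ab i; have := tie_inj i f aa bb; rewrite -/(on _ _) => E.
have Ua := ultra_comp_arg i (ultra_meetl ab).
have Ub := ultra_comp_arg i (ultra_meetr ab).
have : ~ U (anti i (tie i (aa i) (bb i))).
  by move=> UA; apply: ultra0; rewrite -E; apply/ultra_on.
by rewrite ultra_anti => /contrapT /ultra_tie [] // [].
Qed.

End InUltra.

Lemma ultra_separates x y : x <> y ->
  exists2 U, ultra U & ~ U (x ** y) /\ (U x \/ U y).
Proof.
move=> xy.
have [i tie_n1] : exists i, tie i x y <> proj bot i.
  apply: contrapT => /forallNP tie1; apply: xy; have := ties_comp x y.
  have -> : ties x y = proj bot by apply/funext=> i; exact: (contrapT (tie1 i)).
  by rewrite !proj_comp.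
have [|U UU /(ultra_anti UU) Utie] := @ultra_ex (anti i (tie i x y)).
  move=> tie0; apply: tie_n1; rewrite -(anti_bot) -tie0.
  by rewrite /tie /plus anti3.
exists U => //; rewrite (ultra_tie UU) in Utie.
by case: (pselect (U x)) (pselect (U y)) => Ux [] Uy; tauto.
Qed.

(** * The representation by germs *)

Definition agree_class (U : set A) a : set A := [set b | agree U a b].

(** Germs are represented by the equivalence classes themselves, with the
   ultrafilter recorded.  The proof field keeps out all other pairs: at such a
   point no represented element is defined, hence the antidomain computed on
   graphs always is, and it would not be a represented element. *)
Record germ := Germ {
  filt : set A;
  elt : set A;
  germP : ultra filt /\ exists2 a, filt a & elt = agree_class filt a }.

Definition same_filt (p q : germ) : Prop := filt p = filt q.

Definition names U a (p : germ) : Prop :=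
  [/\ filt p = U, U a & elt p = agree_class U a].

Definition rep a : graph n germ :=
  [set xy | exists U aa,
     (forall i, names U (aa i) (xy.1 i)) /\ names U (aa ;; a) xy.2].

Lemma names_ultra U a p : names U a p -> ultra U.
Proof. by case=> <- _ _; case: (germP p). Qed.

Lemma names_filt p : exists a, names (filt p) a p.
Proof. by have [_ [a Ua pa]] := germP p; exists a. Qed.

Lemma names_ex U a : ultra U -> U a -> exists p, names U a p.
Proof.
move=> UU Ua.
by exists (@Germ U (agree_class U a) (conj UU (ex_intro2 _ _ a Ua erefl))).
Qed.

Lemma germ_ext p q : filt p = filt q -> elt p = elt q -> p = q.
Proof.
case: p q => [U e Ue] [V f Vf] /= UV ef; rewrite UV ef in Ue *.
by congr Germ.
Qed.

Lemma names_uniq U a p q : names U a p -> names U a q -> p = q.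
Proof. by case=> [pU _ pa] [qU _ qa]; apply: germ_ext; congruence. Qed.

Lemma names_agree U a b p : names U a p -> names U b p <-> agree U a b.
Proof.
move=> pa; have UU := names_ultra pa; have [pU Ua paE] := pa; split.
  move=> [_ Ub pbE]; have : agree_class U b b by apply/agree_refl.
  by rewrite -pbE paE.
move=> ab; have ba := agree_sym ab; split=> //; first exact: ultra_meetr ab.
by rewrite paE; apply/predeqP=> c; split; apply: agree_trans.
Qed.

Lemma names_tuple (x : 'I_n -> germ) : (forall i j, same_filt (x i) (x j)) ->
  exists U aa, forall i, names U (aa i) (x i).
Proof.
move=> xE; have [aa aax] := choice (fun i => names_filt (x i)).
by exists (filt (x i0)), aa => i; rewrite (xE i0 i).
Qed.

(** The action does not depend on the names of the arguments.  With names fixed,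
   every operation is computed in [A], and the following lemmas translate the
   laws of [A]. *)
Lemma rep_names U aa f (x : 'I_n -> germ) (y : germ) :
  (forall i, names U (aa i) (x i)) ->
  rep f (x, y) <-> names U (aa ;; f) y.
Proof.
move=> xa; split=> [[V [bb [/= xb yb]]]|ya]; last by exists U, aa.
have VU : V = U by have [<- _ _] := xb i0; have [<- _ _] := xa i0.
subst V; have UU := names_ultra yb; have [_ Ubf _] := yb.
apply/(names_agree (aa ;; f) yb); apply: agree_comp => // i.
exact/(names_agree _ (xb i)).
Qed.

Lemma rep_same_filt f (x : 'I_n -> germ) (y : germ) : rep f (x, y) ->
  (forall i j, same_filt (x i) (x j)) /\ forall i, same_filt (x i) y.
Proof.
move=> [U [aa [/= xa [yU _ _]]]]; rewrite /same_filt.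
by split=> [i j|i]; have [-> _ _] := xa i => //; have [-> _ _] := xa j.
Qed.

Lemma rep_functional f (x : 'I_n -> germ) (y z : germ) :
  rep f (x, y) -> rep f (x, z) -> y = z.
Proof.
move=> [U [aa [/= xa ya]]] /(rep_names _ _ xa); exact: names_uniq.
Qed.

Lemma rep_injective f (x y : 'I_n -> germ) (z : germ) :
  rep f (x, z) -> rep f (y, z) -> x = y.
Proof.
move=> [U [aa [/= xa za]]] [V [bb [/= yb zb]]].
have VU : V = U by have [<- _ _] := zb; have [<- _ _] := za.
subst V; have UU := names_ultra za.
have /(agree_inj UU) ab := proj1 (names_agree _ za) zb.
apply/funext=> i; apply: names_uniq (yb i).
by apply/(names_agree _ (xa i)).
Qed.

Lemma rep_comp aa f : rep (aa ;; f) = graph_comp (fun i => rep (aa i)) (rep f).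
Proof.
apply/predeqP=> -[x z]; split.
  move=> [U [bb [/= xb]]]; rewrite compA => zb.
  have UU := names_ultra zb; have [_ Uz _] := zb.
  have [y yb] := choice (fun i => names_ex UU (ultra_comp_arg UU i Uz)).
  exists y; split=> /= [i|]; first by exists U, bb.
  by exists U, (fun i => bb ;; aa i).
move=> [y /= [xy yz]]; have [U [bb [/= xb _]]] := xy i0.
have yb i : names U (bb ;; aa i) (y i) by apply/(rep_names _ _ xb).
by exists U, bb; split=> //=; rewrite compA; apply/(rep_names _ _ yb).
Qed.

Lemma rep_dom U aa f (x : 'I_n -> germ) : (forall i, names U (aa i) (x i)) ->
  (exists y : germ, rep f (x, y)) <-> U (aa ;; f).
Proof.
move=> xa; have UU := names_ultra (xa i0); split.
  by move=> [y /(rep_names _ _ xa) []].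
by move=> /(names_ex UU) [y ya]; exists y; apply/(rep_names _ _ xa).
Qed.

Lemma rep_anti i f : rep (anti i f) = graph_anti same_filt i (rep f).
Proof.
apply/predeqP=> -[x y]; split=> [xy|[/= -> [xE xf]]].
  have [xE _] := rep_same_filt xy; have [U [aa xa]] := names_tuple xE.
  have UU := names_ultra (xa i).
  have := proj1 (rep_names _ _ xa) xy; rewrite comp_anti => ya.
  have [_ /[dup] Uy /(ultra_off UU) [Uaf Ur] _] := ya.
  split=> /=; last by split=> //; rewrite (rep_dom _ xa).
  apply: (names_uniq _ (xa i)); apply/(names_agree _ ya).
  by apply: (agree_trans UU (agree_off UU Uy)); apply: agree_restr_self.
have [U [aa xa]] := names_tuple xE; have UU := names_ultra (xa i).
rewrite (rep_dom _ xa) in xf; apply/(rep_names _ _ xa)/(names_agree _ (xa i)).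
have Ur : U (restr aa (aa i)).
  by apply/(ultra_restr UU); split=> [j|]; [have [] := xa j | have [] := xa i].
have Uy : U (off (aa ;; f) (restr aa (aa i))) by apply/(ultra_off UU).
rewrite comp_anti; apply: agree_sym.
by apply: (agree_trans UU (agree_off UU Uy)); apply: agree_restr_self.
Qed.

Lemma rep_meet f g : rep (f ** g) = rep f `&` rep g.
Proof.
apply/predeqP=> -[x y]; split.
  move=> [U [aa [/= xa ya]]]; have UU := names_ultra ya.
  rewrite comp_meet in ya; have [_ Uy _] := ya.
  have yf : names U (aa ;; f) y by apply/(names_agree _ ya)/(agree_meetl UU).
  split; apply/(rep_names _ _ xa) => //; apply/(names_agree _ yf); exact: Uy.
move=> [[U [aa [/= xa yf]]] /(rep_names _ _ xa) yg]; have UU := names_ultra yf.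
exists U, aa; split=> //=; rewrite comp_meet.
have fg := proj1 (names_agree _ yf) yg.
apply/(names_agree _ yf); apply: agree_sym; exact: (agree_meetl UU fg).
Qed.

Local Notation G := (graph_alg n same_filt).

Lemma rep_on f g : rep (on f g) = doms (rep f : G) ;; rep g.
Proof.
rewrite rep_comp; congr (graph_comp _ _); apply/funext=> i.
by rewrite !rep_anti.
Qed.

Lemma rep_off f g : rep (off f g) = antis (rep f : G) ;; rep g.
Proof.
rewrite rep_comp; congr (graph_comp _ _); apply/funext=> i.
by rewrite !rep_anti.
Qed.

(** Preferential union is determined by its restrictions on and off [f], which
   are expressed with operations that are already known to be preserved. *)
Lemma rep_pref f g : rep (f |_| g) = graph_pref (rep f) (rep g).
Proof.
have fE : rep f = _ := congr1 rep (esym (on_pref f g)).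
have gE : rep _ = rep _ := congr1 rep (off_pref f g).
rewrite rep_on in fE; rewrite !rep_off in gE.
apply: (@graphP n germ same_filt) => x y.
case: (pselect (defined (rep f : G) x)) => dfx.
  have fxy : rep f (x, y) <-> rep (f |_| g) (x, y).
    rewrite {1}fE doms_comp //; split=> [[]//|xy]; split=> //; split=> //.
    by have [] := rep_same_filt xy.
  by rewrite -fxy; split=> [xy|[//|[]//]]; left.
have gxy : rep (f |_| g) (x, y) <-> rep g (x, y).
  have := antis_comp i0 (rep f : G) (rep (f |_| g)) x y.
  rewrite gE antis_comp // => H.
  split=> xy; have [cx _] := rep_same_filt xy; tauto.
rewrite gxy; split=> [xy|[xy|[]//]]; first by right.
by case: dfx; exists y.
Qed.

Lemma rep_is_hom : @is_hom n A G rep.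
Proof.
split; [exact: rep_comp | exact: rep_anti | exact: rep_meet | exact: rep_pref].
Qed.

(** Evaluation at the germs of the projections sends [f] to its own germ. *)
Lemma rep_inj : injective rep.
Proof.
move=> a b ab; apply: contrapT => /ultra_separates [U UU [Uab aUb]].
have Up i : U (proj bot i).
  by rewrite /proj (ultra_anti UU) zeroE; apply: ultra0.
have [x xp] := choice (fun i => names_ex UU (Up i)).
have repE f (y : germ) : rep f (x, y) <-> names U f y.
  by rewrite (rep_names _ _ xp) proj_comp.
apply: Uab; have [y [ya yb]] : exists y : germ, names U a y /\ names U b y.
  by case: aUb => /(names_ex UU) [y yn]; exists y; split=> //; apply/repE;
    [rewrite -ab | rewrite ab]; apply/repE.
exact/(names_agree _ ya).
Qed.

End Laws.

(** * Representable algebras are the models of the equations *)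

Section HomImage.
Variables (n : nat) (A B : alg n) (h : A -> B).
Hypothesis hh : is_hom h.

Lemma hom_image_nonempty : exists b, range h b.
Proof. by have [a] := alg_nonempty A; exists (h a), a. Qed.

Lemma hom_image_comp (b : 'I_n -> B) c :
  (forall i, range h (b i)) -> range h c -> range h (b ;; c).
Proof.
move=> hb [a _ <-].
have hb' i : exists a, h a = b i by have [f _ fb] := hb i; exists f.
have [f fb] := choice hb'.
by exists (f ;; a) => //; rewrite (hom_comp hh); congr (_ ;; _); apply/funext.
Qed.

Lemma hom_image_anti i b : range h b -> range h (anti i b).
Proof. by move=> [a _ <-]; exists (anti i a) => //; apply: hom_anti. Qed.

Lemma hom_image_meet b c : range h b -> range h c -> range h (b ** c).
Proof. by move=> [a _ <-] [d _ <-]; exists (a ** d) => //; apply: hom_meet. Qed.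

Lemma hom_image_pref b c : range h b -> range h c -> range h (b |_| c).
Proof.
by move=> [a _ <-] [d _ <-]; exists (a |_| d) => //; apply: hom_pref.
Qed.

Definition hom_image : subuniverse B :=
  Subuniverse hom_image_nonempty hom_image_comp hom_image_anti hom_image_meet
    hom_image_pref.

Lemma hom_image_isomorphic : injective h -> isomorphic A (sub_alg hom_image).
Proof.
move=> hi; have him a : hom_image (h a) by exists a.
pose f a : sub_alg hom_image := exist _ (h a) (him a).
have sval_inj' (x y : sub_alg hom_image) : sval x = sval y -> x = y.
  by case: x y => [x Sx] [y Sy] /= xy; subst y; congr exist.
have preimage (y : sub_alg hom_image) : exists a, h a = sval y.
  by have [a _ ab] := svalP y; exists a.
have [g gK] := choice preimage.
exists f; split; last first.
  exists g => [a|y]; first by apply: hi; rewrite gK.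
  by apply: sval_inj'; rewrite /= gK.
split=> *; apply: sval_inj'; rewrite /=.
- by rewrite (hom_comp hh).
- by rewrite (hom_anti hh).
- by rewrite (hom_meet hh).
- by rewrite (hom_pref hh).
Qed.

End HomImage.

Lemma models_representable (n : nat) (A : alg n) : 0 < n ->
  models A (axioms n) -> injectively_representable A.
Proof.
move=> n0 M; pose i0 := Ordinal n0.
have h := rep_is_hom M i0.
exists (@germ n A), (@same_filt n A), (hom_image h); split; last split.
- split; first by split=> [p|p q|p q r]; rewrite /same_filt; congruence.
  move=> f [a _ <-]; split.
    by move=> x y z; apply: rep_functional M i0 _ _ _ _.
  by move=> x y; apply: rep_same_filt.
- by move=> f [a _ <-] x y z; apply: rep_injective M i0 _ _ _ _.
- exact: (hom_image_isomorphic h (rep_inj M i0)).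
Qed.

Theorem corollary7p7 (n : nat) (hn : (1 <= n)%N) :
  is_variety (@injectively_representable n) /\
  forall A : alg n, injectively_representable A <-> models A (axioms n).
Proof.
have reprP (A : alg n) : injectively_representable A <-> models A (axioms n).
  split; [exact: representable_models | exact: models_representable].
split=> //.
have -> : @injectively_representable n = fun A => models A (axioms n).
  by apply/funext=> A; apply/propext.
exact: models_is_variety.
Qed.
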